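(* Let $\Omega$ be a compact metric space, let $K$ be a kernel on $\Omega\times\Omega$, and assume that $\mu\in\mathbb P(\Omega)$ is $K$-invariant, i.e. $U_K^\mu(x)=I_K(\mu)$ for every $x\in\Omega$. Then $\mu$ minimizes $I_K$ over $\widetilde{\mathbb P}(\Omega)$ if and only if $K$ is conditionally positive definite. Moreover, $\mu$ uniquely minimizes $I_K$ over $\widetilde{\mathbb P}(\Omega)$ if and only if $K$ is conditionally strictly positive definite.
   Context: A kernel on $\Omega\times\Omega$ is a continuous symmetric function $K:\Omega\times\Omega\to\mathbb R$. $\mathcal M(\Omega)$ is the set of finite regular signed Borel measures on $\Omega$; $\mathbb P(\Omega)$ the Borel probability measures; $\widetilde{\mathbb P}(\Omega)$ the set of $\nu\in\mathcal M(\Omega)$ with $\nu(\Omega)=1$; $\mathcal Z(\Omega)$ the set of $\nu\in\mathcal M(\Omega)$ with $\nu(\Omega)=0$. $I_K(\mu)=\int_\Omega\int_\Omega K(x,y)\,d\mu(x)\,d\mu(y)$ and $U_K^\mu(x)=\int_\Omega K(x,y)\,d\mu(y)$. $K$ is conditionally positive definite if $I_K(\nu)\ge0$ for every $\nu\in\mathcal Z(\Omega)$; conditionally strictly positive definite if in addition $I_K(\nu)=0$ with $\nu\in\mathcal Z(\Omega)$ only if $\nu=0$. *)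

(* Defs.v *)
From HB Require Import structures.
From mathcomp Require Import all_boot all_order all_algebra.
From mathcomp Require Import all_classical all_reals all_analysis.

Set Implicit Arguments.
Unset Strict Implicit.
Unset Printing Implicit Defensive.

Import Order.TTheory GRing.Theory Num.Theory.
Import numFieldNormedType.Exports.

Local Open Scope classical_set_scope.
Local Open Scope ring_scope.

(* Measurable types are pointed in the library.  The base point is never used;
   it only makes the space nonempty, which the existence of a Borel probability
   measure forces anyway. *)
#[short(type="pmetricType")]
HB.structure Definition PointedMetric (R : numDomainType) :=
  {M of Metric R M & Pointed M}.

Definition borelType (T : ptopologicalType) := g_sigma_algebraType (@open T).

Notation signed_measure R T := ({charge set (borelType T) -> \bar R}).

Section signed_measures.
Context {R : realType} {T : ptopologicalType}.
Implicit Type nu : signed_measure R T.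

(* A Hahn decomposition is only unique up to null sets; the Jordan parts below
   do not depend on the choice made here. *)
Definition hahn_posset nu : set (borelType T) :=
  sval (cid (Hahn_decomposition nu)).

Definition hahn_negset nu : set (borelType T) :=
  sval (cid (svalP (cid (Hahn_decomposition nu)))).

Lemma hahn_setsP nu :
  hahn_decomposition nu (hahn_posset nu) (hahn_negset nu).
Proof. exact: (svalP (cid (svalP (cid (Hahn_decomposition nu))))). Qed.

Definition total_variation nu : {measure set (borelType T) -> \bar R} :=
  charge_variation (hahn_setsP nu).

(* The difference of the integrals against the two Jordan parts.  [Rintegral]
   sends infinite integrals to 0, which never happens for a bounded Borel
   function, in particular for a continuous function on a compact space. *)
Definition signed_integral nu (f : T -> R) : R :=
  Rintegral (jordan_pos (hahn_setsP nu)) [set: borelType T] f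
  - Rintegral (jordan_neg (hahn_setsP nu)) [set: borelType T] f.

Definition regular_measure (m : {measure set (borelType T) -> \bar R}) :=
  forall A : set (borelType T), measurable A ->
    m A = ereal_inf [set m U | U in [set U : set T | open U /\ A `<=` U]] /\
    m A = ereal_sup [set m C | C in [set C : set T | compact C /\ C `<=` A]].

(* Charges are functions on all subsets, with unconstrained values outside the
   Borel sets, so measures have to be compared on the Borel sets only. *)
Definition same_measure nu1 nu2 :=
  forall A : set (borelType T), measurable A -> nu1 A = nu2 A.

(* Charges take finite values on measurable sets. *)
Definition regular_signed_measures : set (signed_measure R T) :=
  [set nu | regular_measure (total_variation nu)].

Definition unit_mass_measures : set (signed_measure R T) :=
  [set nu | regular_signed_measures nu /\ nu [set: borelType T] = 1%E].

Definition zero_mass_measures : set (signed_measure R T) :=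
  [set nu | regular_signed_measures nu /\ nu [set: borelType T] = 0%E].

Definition is_kernel (K : T * T -> R) :=
  continuous K /\ forall x y, K (x, y) = K (y, x).

Definition energy (K : T * T -> R) nu : R :=
  signed_integral nu (fun y => signed_integral nu (fun x => K (x, y))).

Definition potential (K : T * T -> R) nu (x : T) : R :=
  signed_integral nu (fun y => K (x, y)).

Definition invariant_measure (K : T * T -> R) nu :=
  forall x, potential K nu x = energy K nu.

Definition cond_posdef (K : T * T -> R) :=
  forall nu, zero_mass_measures nu -> 0 <= energy K nu.

Definition cond_strict_posdef (K : T * T -> R) :=
  cond_posdef K /\
  forall nu, zero_mass_measures nu -> energy K nu = 0 -> same_measure nu czero.

Definition minimizes (F : signed_measure R T -> R)
    (D : set (signed_measure R T)) nu :=
  D nu /\ forall nu', D nu' -> F nu <= F nu'.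

Definition uniquely_minimizes (F : signed_measure R T -> R)
    (D : set (signed_measure R T)) nu :=
  minimizes F D nu /\ forall nu', minimizes F D nu' -> same_measure nu' nu.

End signed_measures.

(* Main.v *)
Require Import Defs.
From HB Require Import structures.
From mathcomp Require Import all_boot all_order all_algebra.
From mathcomp Require Import all_classical all_reals all_analysis.
From mathcomp Require Import measurable_realfun.
From mathcomp Require Import ring.

Set Implicit Arguments.
Unset Strict Implicit.
Unset Printing Implicit Defensive.

Import Order.TTheory GRing.Theory Num.Theory.
Import numFieldNormedType.Exports.

Local Open Scope classical_set_scope.
Local Open Scope ring_scope.

(** Write [I] for the energy.  Since [mu] has total mass 1, [nu |-> mu + nu] is
a bijection from the measures of mass 0 onto the measures of mass 1.  The energy
is a quadratic form, so
  [I(mu + nu) = I(mu) + I(nu) + 2 * \int U_mu dnu],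
and invariance makes the potential [U_mu] constant, so that the cross term is
that constant times [nu(Omega) = 0].  Hence [I(mu + nu) = I(mu) + I(nu)]
exactly ([energyD_invariant]): [mu] minimizes the energy if and only if [I] is
nonnegative on the measures of mass 0, and then a second minimizer is the same
thing as a nonzero [nu] of mass 0 and energy 0.

Three facts support this computation.
- Both cross terms [\int U_nu dmu] and [\int U_mu dnu] occur, and they agree by
  Fubini's theorem.  This needs the kernel to be measurable for the product of
  the Borel sigma-algebras, which holds because a compact metric space is
  second countable ([open_borel_prod]).
- Signed integrals are defined through the Jordan decomposition, which is not
  additive in the measure.  Additivity comes from computing the integral with
  any decomposition as a difference of finite measures
  ([signed_integral_diff]).
- Sums and differences of signed measures have to be regular; in fact every
  finite Borel measure on a compact metric space is ([finite_borel_regular]). *)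

(** * Borel sets of a topological space and of its square *)

Section borel_sets.
Context {R : realType} {T : ptopologicalType}.

Lemma open_borel (A : set T) : open A -> measurable (A : set (borelType T)).
Proof. exact: sub_sigma_algebra. Qed.

Lemma closed_borel (A : set T) : closed A -> measurable (A : set (borelType T)).
Proof.
move=> cA; rewrite -[A]setCK; apply: measurableC.
by apply: open_borel; exact: closed_openC.
Qed.

(** The product sigma-algebra contains the open rectangles; a countable basis
makes an open subset of the square a countable union of rectangles with sides
in the basis. *)
Lemma open_borel_prod (W : set (T * T)) : @second_countable T -> open W ->
  measurable (W : set (borelType T * borelType T)).
Proof.
move=> [B cB [oB bB]] oW.
pose D := [set UV : set T * set T | [/\ B UV.1, B UV.2 & UV.1 `*` UV.2 `<=` W]].
have -> : W = \bigcup_(UV in D) (UV.1 `*` UV.2).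
  apply/seteqP; split => [[x y] Wxy|z [UV [_ _ UVW] /UVW//]].
  have [[P Q] /= [Px Qy] PQW] : nbhs (x, y) W by exact: open_nbhs_nbhs.
  have [U [BU Ux] UP] := bB x _ Px.
  have [V [BV Vy] VQ] := bB y _ Qy.
  exists (U, V) => //; split => //= -[x' y'] [/= /UP Px' /VQ Qy'].
  exact: PQW.
rewrite bigcup_set_type; apply: countable_bigcupT_measurable => [|UV].
  rewrite (eq_countable (card_setT D)).
  by apply: sub_countable (countableX cB cB); apply: subset_card_le => UV [].
have [BU BV _] : D (val UV) by exact: set_valP.
by apply: measurableX; apply: open_borel; exact: oB.
Qed.

Lemma continuous_borel_prod (K : T * T -> R) : @second_countable T ->
  continuous K -> measurable_fun [set: borelType T * borelType T] K.
Proof.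
move=> sT /continuousP cK.
apply: (measurability _ (RGenOpens.measurableE R)).
move=> _ [_ [a [b ->] <-]]; rewrite setTI; apply: open_borel_prod => //.
by apply: cK; exact: interval_open.
Qed.

End borel_sets.

(** * Regularity of finite Borel measures on metric spaces *)

Section regularity.
Context {R : realType} {T : pmetricType R}.
Variable m : {measure set (borelType T) -> \bar R}.
Hypothesis mfin : fin_num_fun m.
Implicit Types A F U : set T.

(** Continuity from above, in the form used to replace a countable operation by
a finite one at an arbitrarily small cost. *)
Lemma measure_decreasing_lt (D : (set (borelType T))^nat) (e : \bar R) :
  (forall n, measurable (D n)) -> {homo D : n k / (n <= k)%N >-> (k <= n)%O} ->
  (m (\bigcap_n D n) < e)%E -> exists n, (m (D n) < e)%E.
Proof.
move=> mD dD De.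
have cvgD : m (D n) @[n --> \oo] --> m (\bigcap_n D n).
  apply: (@nonincreasing_cvg_mu _ _ _ m D) => //.
    by rewrite ltey_eq mfin.
  exact: bigcapT_measurable.
have [n _ Dn] := cvgD _ (open_ereal_lt' De).
by exists n; exact: (Dn n (leqnn n)).
Qed.

(** Unlike regularity itself, this condition is symmetric under complement, so
that the sets satisfying it form a sigma-algebra. *)
Definition squeezable A := forall e : R, 0 < e ->
  exists F U, [/\ closed F, open U, F `<=` A, A `<=` U &
    (m (U `\` F) < e%:E)%E].

(** Here the metric enters: an open set [U] is the increasing union of the
closed sets of points at distance at least [1/(n+1)] from the
complement of [U]. *)
Lemma open_squeezable U : open U -> squeezable U.
Proof.
move=> oU e e0.
pose V n := \bigcup_(y in ~` U) (ball y (n.+1%:R^-1 : R))°.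
have oV n : open (V n) by apply: bigcup_open => y _; exact: open_interior.
have UV n : ~` U `<=` V n.
  by move=> y Uy; exists y => //; apply: nbhsx_ballx; rewrite invr_gt0.
have [|||n mn] := @measure_decreasing_lt (fun n => U `&` V n) e%:E.
- by move=> n; apply: open_borel; exact: openI.
- move=> n k nk; apply/subsetPset; apply: setIS => x [y Uy yx]; exists y => //.
  apply: interiorS yx; apply: le_ball.
  by rewrite lef_pV2 ?posrE// ler_nat.
- rewrite [X in m X](_ : _ = set0) ?measure0 ?lte_fin//.
  apply/seteqP; split => // x Ux; have [Ux0 _] := Ux 0%N Logic.I.
  have /nbhs_ballP[d d0 dU] : nbhs x U by exact: open_nbhs_nbhs.
  have [n nd] : exists n : nat, n.+1%:R^-1 < d :> R.
    by have [//|n nd] := @ltr_add_invr R 0 d _; exists n; rewrite add0r in nd.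
  have [_ [y Uy /interior_subset yx]] := Ux n Logic.I.
  by apply: Uy; apply: dU; apply: ball_sym; apply: le_ball yx; exact: ltW.
exists (~` V n), U; split => //.
- exact: open_closedC.
- by rewrite -[X in _ `<=` X]setCK; apply: subsetC; exact: UV.
- by rewrite setDE setCK.
Qed.

Lemma squeezableC A : squeezable A -> squeezable (~` A).
Proof.
move=> sA e /sA[F [U [cF oU FA AU FUe]]]; exists (~` U), (~` F); split.
- exact: open_closedC.
- exact: closed_openC.
- exact: subsetC.
- exact: subsetC.
- by rewrite setDE setCK setIC -setDE.
Qed.

(** The union of the inner closed sets need not be closed; finitely many of
them exhaust it up to a small measure. *)
Lemma squeezable_bigcup (A : (set T)^nat) :
  (forall n, squeezable (A n)) -> squeezable (\bigcup_n A n).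
Proof.
move=> sA e e0.
(* The errors sum to [e / 2], which leaves room for the strict bound [e]. *)
have /choice[FU FUP] : forall n, exists FU : set T * set T,
    [/\ closed FU.1, open FU.2, FU.1 `<=` A n, A n `<=` FU.2 &
      (m (FU.2 `\` FU.1) < (e / 2 / (2 ^ n.+1)%:R)%:E)%E].
  move=> n; have [|F [U FUP]] := sA n (e / 2 / (2 ^ n.+1)%:R).
    by rewrite !divr_gt0// ltr0n expn_gt0.
  by exists (F, U).
pose F n := (FU n).1; pose U n := (FU n).2.
have cF n : closed (F n) by have [] := FUP n.
have oU n : open (U n) by have [] := FUP n.
have mUF n : measurable (U n `\` F n : set (borelType T)).
  by apply: measurableD; [exact: open_borel|exact: closed_borel].
pose UU := \bigcup_n U n; pose FF n := \big[setU/set0]_(i < n) F i.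
have oUU : open UU by exact: bigcup_open.
have cFF n : closed (FF n) by apply: closed_bigsetU.
have [|||n mn] := @measure_decreasing_lt (fun n => UU `\` FF n) e%:E.
- by move=> n; apply: measurableD; [exact: open_borel|exact: closed_borel].
- move=> n k nk; apply/subsetPset; apply: setDS.
  exact: subset_bigsetU.
- apply: (@le_lt_trans _ _ (e / 2)%:E); last first.
    by rewrite lte_fin ltr_pdivrMr// ltr_pMr// ltr1n.
  apply: le_trans (epsilon_trick0 xpredT _); last by rewrite divr_ge0 ?ltW.
  apply: (@le_trans _ _ (\sum_(0 <= n <oo) m (U n `\` F n))%E); last first.
    by apply: lee_nneseries => // n _; apply: ltW; have [] := FUP n.
  apply: measure_sigma_subadditive => //.
    apply: bigcapT_measurable => n.
    by apply: measurableD; [exact: open_borel|exact: closed_borel].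
  move=> x UFx; have [[n _ Unx] _] := UFx 0%N Logic.I.
  exists n => //; split => // Fnx; have [_ /=] := UFx n.+1 Logic.I; apply.
  by rewrite /FF big_ord_recr; right.
exists (FF n), UU; split => //.
- rewrite /FF -bigcup_mkord => x [i _ Fix]; exists i => //.
  by have [_ _ FA _ _] := FUP i; exact: FA.
- by move=> x [i _ Aix]; exists i => //; have [_ _ _ AU _] := FUP i; exact: AU.
Qed.

Lemma borel_squeezable (A : set (borelType T)) : measurable A -> squeezable A.
Proof.
apply: smallest_sub; last exact: open_squeezable.
split.
- by apply: open_squeezable; exact: open0.
- by move=> B sB; rewrite setTD; exact: squeezableC.
- exact: squeezable_bigcup.
Qed.

(** In a compact space the closed sets of a squeeze are compact, and finiteness
turns the small measure of [U `\` F] into closeness of the measures. *)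
Lemma finite_borel_regular : compact [set: T] -> regular_measure m.
Proof.
move=> cT A mA.
split; apply/eqP; rewrite eq_le; apply/andP; split.
- apply: le_ereal_inf_tmp => _ [U [oU AU] <-].
  by apply: le_measure => //; rewrite inE//; exact: open_borel.
- apply/lee_addgt0Pr => e e0.
  have [F [U [cF oU FA AU FUe]]] := borel_squeezable mA e0.
  apply: ge_ereal_inf; exists (m U); first by exists U.
  have mF := closed_borel cF; have mU := open_borel oU.
  rewrite (_ : U = A `|` (U `\` F)); last first.
    apply/seteqP; split=> [x Ux|x [/AU//|[]//]].
    by have [Fx|Fx] := pselect (F x); [left; exact: FA|right].
  apply: le_trans (measureU2 _ _ _) _ => //; first exact: measurableD.
  by rewrite leeD2l// ltW.
- apply/lee_addgt0Pr => e e0.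
  have [F [U [cF oU FA AU FUe]]] := borel_squeezable mA e0.
  have mF := closed_borel cF; have mU := open_borel oU.
  apply: (@le_trans _ _ (m F + e%:E)%E); last first.
    rewrite leeD2r//; apply: ereal_sup_ubound; exists F => //; split => //.
    exact: subclosed_compact cT _.
  apply: (@le_trans _ _ (m (F `|` (U `\` F)))).
    apply: le_measure; rewrite ?inE//.
      by apply: measurableU => //; exact: measurableD.
    by move=> x /AU Ux; have [Fx|Fx] := pselect (F x); [left|right].
  apply: le_trans (measureU2 _ _ _) _ => //; first exact: measurableD.
  by rewrite leeD2l// ltW.
- apply: ge_ereal_sup => _ [C [cC CA] <-].
  apply: le_measure => //; rewrite inE//; apply: closed_borel.
  exact: (compact_closed (@metric_hausdorff _ _) cC).
Qed.

End regularity.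

(** * Signed integrals of bounded Borel functions *)

(** A class of functions integrable for every finite Borel measure, and stable
under integrating out one variable of a kernel. *)
Definition bounded_borel {R : realType} {T : ptopologicalType} (f : T -> R) :=
  measurable_fun [set: borelType T] (f : borelType T -> R) /\
  exists M, forall x, `|f x| <= M.

Section signed_integral.
Context {R : realType} {T : ptopologicalType}.
Implicit Types (f g : T -> R) (nu : signed_measure R T).
Implicit Type m : {measure set (borelType T) -> \bar R}.

Local Notation posm nu := (jordan_pos (hahn_setsP nu)).
Local Notation negm nu := (jordan_neg (hahn_setsP nu)).

Lemma bounded_borelB f g : bounded_borel f -> bounded_borel g ->
  bounded_borel (fun x => f x - g x).
Proof.
move=> [mf [M fM]] [mg [N gN]]; split; first exact: measurable_funB.
by exists (M + N) => x; rewrite (le_trans (ler_normB _ _))// lerD.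
Qed.

Lemma bounded_borel_integrable m f : (m setT < +oo)%E -> bounded_borel f ->
  m.-integrable [set: borelType T] (EFin \o f).
Proof.
move=> moo [mf [M fM]]; apply: measurable_bounded_integrable => //.
exists M; split; first exact: num_real.
by move=> N MN x _; exact: le_trans (fM x) (ltW MN).
Qed.

Lemma finite_measureT (m : {finite_measure set (borelType T) -> \bar R}) :
  (m setT < +oo)%E.
Proof. by rewrite ltey_eq fin_num_measure. Qed.

Lemma jordan_decompE nu (A : set (borelType T)) : measurable A ->
  nu A = (posm nu A - negm nu A)%E.
Proof.
by move=> mA; rewrite (jordan_decomp (hahn_setsP nu))// /cadd/= cscaleN1.
Qed.

Lemma Rintegral_measure_add m1 m2 f :
  (m1 setT < +oo)%E -> (m2 setT < +oo)%E -> bounded_borel f ->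
  Rintegral (measure_add m1 m2) setT f =
  Rintegral m1 setT f + Rintegral m2 setT f.
Proof.
move=> m1oo m2oo bf.
have i1 := bounded_borel_integrable m1oo bf.
have i2 := bounded_borel_integrable m2oo bf.
by rewrite /Rintegral integral_measure_add// fineD// integrable_fin_num.
Qed.

(** With [P] and [N] the Jordan parts of [nu], the measures [m1 + N] and
[P + m2] coincide: any expression of [nu] as [m1 - m2] computes the signed
integral.  The hypothesis is stated additively to avoid subtracting extended reals. *)
Lemma signed_integral_diff nu m1 m2 f :
  (m1 setT < +oo)%E -> (m2 setT < +oo)%E ->
  (forall A : set (borelType T), measurable A -> m1 A = nu A + m2 A)%E ->
  bounded_borel f ->
  signed_integral nu f = Rintegral m1 setT f - Rintegral m2 setT f.
Proof.
move=> m1oo m2oo m12 bf; apply/eqP; rewrite /signed_integral subr_eq addrAC.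
rewrite eq_sym subr_eq -!Rintegral_measure_add ?finite_measureT//.
apply/eqP; congr fine; apply: eq_measure_integral => A mA _.
rewrite [LHS]measure_addE [RHS]measure_addE m12// jordan_decompE//.
by rewrite addeAC subeK// fin_num_measure.
Qed.

(** The sums of the Jordan parts of [nu1] and [nu2] are in general not the
Jordan parts of [nu], but they do decompose it. *)
Lemma signed_integral_addl nu nu1 nu2 f :
  (forall A : set (borelType T), measurable A -> nu A = nu1 A + nu2 A)%E ->
  bounded_borel f ->
  signed_integral nu f = signed_integral nu1 f + signed_integral nu2 f.
Proof.
move=> nuD bf.
have oo m1 m2 :
    (m1 setT < +oo -> m2 setT < +oo -> measure_add m1 m2 setT < +oo)%E.
  by move=> m1oo m2oo; rewrite measure_addE lte_add_pinfty.
rewrite (@signed_integral_diff nu (measure_add (posm nu1) (posm nu2))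
  (measure_add (negm nu1) (negm nu2)))//; last 3 first.
- by apply: oo; exact: finite_measureT.
- by apply: oo; exact: finite_measureT.
- move=> A mA; rewrite [LHS]measure_addE [X in (_ = _ + X)%E]measure_addE nuD//.
  rewrite (jordan_decompE nu1)// (jordan_decompE nu2)//.
  by rewrite addeACA !subeK// fin_num_measure.
rewrite !Rintegral_measure_add ?finite_measureT//.
by rewrite /signed_integral opprD addrACA.
Qed.

Lemma signed_integral_addr nu f g : bounded_borel f -> bounded_borel g ->
  signed_integral nu (fun x => f x + g x) =
  signed_integral nu f + signed_integral nu g.
Proof.
move=> bf bg; rewrite /signed_integral !RintegralD//;
  do ?by apply: bounded_borel_integrable => //; exact: finite_measureT.
by rewrite opprD addrACA.
Qed.

Lemma signed_integral_cst nu (c : R) :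
  signed_integral nu (fun=> c) = c * fine (nu [set: borelType T]).
Proof.
rewrite /signed_integral !Rintegral_cst// -mulrBr jordan_decompE//.
by rewrite fineB// fin_num_measure.
Qed.

End signed_integral.

(** * Fubini's theorem for symmetric bounded functions *)

Section fubini.
Context {R : realType} {T : ptopologicalType}.
Variable h : T * T -> R.
Hypothesis mh : measurable_fun [set: borelType T * borelType T] h.
Variable M : R.
Hypothesis hM : forall z, `|h z| <= M.
Implicit Type m : {finite_measure set (borelType T) -> \bar R}.

Lemma bounded_borel_section x : bounded_borel (fun y => h (x, y)).
Proof.
split; last by exists M.
exact: (@measurable_fun_pair2 _ _ _ (borelType T) (borelType T) _ h x).
Qed.

Lemma integrable_prod m1 m2 : ((m1 \x m2)%E).-integrable
  [set: borelType T * borelType T] (EFin \o h).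
Proof.
apply: measurable_bounded_integrable => //.
  have := product_measure1E m1 m2 (@measurableT _ _) (@measurableT _ _).
  rewrite setXTT => E; rewrite [X in (X < _)%E]E ltey_eq; apply/orP; left.
  by apply: fin_numM; exact: fin_num_measure.
exists M; split; first exact: num_real.
by move=> N MN z _; exact: le_trans (hM z) (ltW MN).
Qed.

Lemma bounded_borel_integral m :
  bounded_borel (fun x => Rintegral m setT (fun y => h (x, y))).
Proof.
split.
  apply: (@measurableT_comp _ _ _ _ _ _ fine _
    (fubini_F m (EFin \o h : borelType T * borelType T -> _))).
    exact: fine_measurable.
  exact: measurable_fubini_F (integrable_prod m m).
exists (M * fine (m setT)) => x.
have ih := bounded_borel_integrable (finite_measureT m)
  (bounded_borel_section x).
rewrite (le_trans (le_normr_Rintegral _ ih))//.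
rewrite -(@Rintegral_cst _ _ _ m setT measurableT M).
apply: le_Rintegral => //.
- exact: integrable_norm.
- exact: finite_measure_integrable_cst.
Qed.

(** Symmetry of [h] absorbs the exchange of its variables, so that only the two
measures trade places. *)
Lemma Rintegral_fubini m1 m2 : (forall x y, h (x, y) = h (y, x)) ->
  Rintegral m1 setT (fun x => Rintegral m2 setT (fun y => h (x, y))) =
  Rintegral m2 setT (fun x => Rintegral m1 setT (fun y => h (x, y))).
Proof.
move=> hC.
have ih (m : {finite_measure set (borelType T) -> \bar R}) x :
    m.-integrable [set: borelType T] (fun y => (h (x, y))%:E).
  exact: bounded_borel_integrable (finite_measureT m) (bounded_borel_section x).
have fineF (m : {finite_measure set (borelType T) -> \bar R}) x :
    (fine (\int[m]_y (h (x, y))%:E))%:E = (\int[m]_y (h (x, y))%:E)%E.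
  by apply: fineK; exact: integrable_fin_num (ih m x).
rewrite /Rintegral; congr fine.
under eq_integral do rewrite fineF.
under [RHS]eq_integral do (rewrite fineF; under eq_integral do rewrite hC).
exact: Fubini (integrable_prod m1 m2).
Qed.

End fubini.

(** * Energies of signed measures *)

Section energy.
Context {R : realType} {T : pmetricType R}.
Hypothesis cT : compact [set: T].
Variable K : T * T -> R.
Hypothesis kK : is_kernel K.
Implicit Types nu : signed_measure R T.

Local Notation posm nu := (jordan_pos (hahn_setsP nu)).
Local Notation negm nu := (jordan_neg (hahn_setsP nu)).

Lemma signed_measure_regular nu : regular_signed_measures nu.
Proof. by apply: finite_borel_regular => // A mA; exact: fin_num_measure. Qed.

Lemma kernel_measurable : measurable_fun [set: borelType T * borelType T] K.
Proof.
have [cK _] := kK.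
by apply: continuous_borel_prod => //; exact: compact_second_countable.
Qed.

Lemma kernel_bounded : exists M, forall z, `|K z| <= M.
Proof.
have [cK _] := kK.
have : compact (K @` [set: T * T]).
  apply: continuous_compact; first exact: continuous_subspaceT.
  by rewrite -setXTT; exact: compact_setX.
move=> /compact_bounded[M [_ KM]]; exists (M + 1) => z.
by apply: (KM (M + 1)); [rewrite ltrDl|exists z].
Qed.

Lemma kernel_section x : bounded_borel (fun y => K (x, y)).
Proof.
have [M KM] := kernel_bounded.
exact: (@bounded_borel_section R T K kernel_measurable M KM x).
Qed.

Lemma bounded_borel_Rintegral_kernel
    (m : {finite_measure set (borelType T) -> \bar R}) :
  bounded_borel (fun x => Rintegral m setT (fun y => K (x, y))).
Proof.
have [M KM] := kernel_bounded.
exact: (@bounded_borel_integral R T K kernel_measurable M KM m).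
Qed.

Lemma bounded_borel_potential nu : bounded_borel (potential K nu).
Proof. by apply: bounded_borelB; exact: bounded_borel_Rintegral_kernel. Qed.

(** The bilinear form of which the energy is the quadratic form. *)
Definition mutual_energy nu1 nu2 := signed_integral nu1 (potential K nu2).

Lemma energyE nu : energy K nu = mutual_energy nu nu.
Proof.
have [_ KC] := kK; congr signed_integral; apply/funext => y.
by congr signed_integral; apply/funext => x; exact: KC.
Qed.

(** Both sides expand into four double integrals against Jordan parts, matched
in pairs by Fubini's theorem. *)
Lemma mutual_energyC nu1 nu2 : mutual_energy nu1 nu2 = mutual_energy nu2 nu1.
Proof.
have [M KM] := kernel_bounded; have [_ KC] := kK.
have intK (m1 m2 : {finite_measure set (borelType T) -> \bar R}) :
    m1.-integrable [set: borelType T]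
      (EFin \o fun x => Rintegral m2 setT (fun y => K (x, y))).
  apply: bounded_borel_integrable; first exact: finite_measureT.
  exact: bounded_borel_Rintegral_kernel.
rewrite /mutual_energy /potential /signed_integral !RintegralB//;
  do ?exact: intK.
have F m1 m2 := @Rintegral_fubini R T K kernel_measurable M KM m1 m2 KC.
rewrite (F (posm nu1) (posm nu2)) (F (posm nu1) (negm nu2)).
rewrite (F (negm nu1) (posm nu2)) (F (negm nu1) (negm nu2)).
by rewrite !opprB !addrA; ring.
Qed.

(** The cross terms vanish: the potential of [mu] is constant and [nu] has mass
0.  Taking [rho] as a separate measure lets this apply both to a given [rho],
with [nu := rho - mu], and to the sum of given [mu] and [nu]. *)
Lemma energyD_invariant (mu nu rho : signed_measure R T) :
  (forall A : set (borelType T), measurable A -> rho A = mu A + nu A)%E ->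
  invariant_measure K mu -> nu [set: borelType T] = 0%E ->
  energy K rho = energy K mu + energy K nu.
Proof.
move=> rhoD imu nu0.
have pD : potential K rho = fun x => potential K mu x + potential K nu x.
  by apply/funext => x; exact: signed_integral_addl rhoD (kernel_section x).
have addp n : signed_integral n (fun x => potential K mu x + potential K nu x) =
    mutual_energy n mu + mutual_energy n nu.
  by apply: signed_integral_addr; exact: bounded_borel_potential.
have cross0 : mutual_energy nu mu = 0.
  rewrite /mutual_energy (_ : potential K mu = fun=> energy K mu);
    last exact/funext.
  by rewrite signed_integral_cst nu0 mulr0.
rewrite !energyE {1}/mutual_energy.
rewrite (signed_integral_addl rhoD (bounded_borel_potential rho)) pD.
rewrite !addp (mutual_energyC mu nu) cross0.
by rewrite addr0 add0r.
Qed.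

(** Translation by [mu] carries the energy on the measures of mass 0 to the
energy on the measures of mass 1, up to the constant [energy K mu]; minimality
at [mu] and uniqueness translate into sign and definiteness at 0. *)
Lemma invariant_minimizer (mu : signed_measure R T) :
  mu [set: borelType T] = 1%E -> invariant_measure K mu ->
  (minimizes (energy K) unit_mass_measures mu <-> cond_posdef K) /\
  (uniquely_minimizes (energy K) unit_mass_measures mu
     <-> cond_strict_posdef K).
Proof.
move=> mu1 imu.
have unit_mu : unit_mass_measures mu.
  by split => //; exact: signed_measure_regular.
have fin (nu : signed_measure R T) (A : set (borelType T)) :
    measurable A -> nu A \is a fin_num by move=> mA; exact: fin_num_measure.
have addE (n1 n2 : signed_measure R T) (A : set (borelType T)) :
    cadd n1 n2 A = (n1 A + n2 A)%E by [].
have subE (n1 n2 : signed_measure R T) (A : set (borelType T)) :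
    cadd n1 (copp n2) A = (n1 A - n2 A)%E by [].
have shift nu : zero_mass_measures nu ->
    unit_mass_measures (cadd mu nu) /\
    energy K (cadd mu nu) = energy K mu + energy K nu.
  move=> [_ nu0]; split; first split; first exact: signed_measure_regular.
    by rewrite [LHS]addE mu1 nu0 adde0.
  exact: energyD_invariant.
have unshift nu : unit_mass_measures nu ->
    zero_mass_measures (cadd nu (copp mu)) /\
    energy K nu = energy K mu + energy K (cadd nu (copp mu)).
  move=> [_ nu1].
  have z : cadd nu (copp mu) setT = 0%E by rewrite [LHS]subE nu1 mu1 subee.
  split; first by split => //; exact: signed_measure_regular.
  apply: energyD_invariant => // A mA.
  by rewrite [X in (_ + X)%E]subE addeCA subee ?fin// adde0.
have minP : minimizes (energy K) unit_mass_measures mu <-> cond_posdef K.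
  split=> [[_ min] nu /shift[unit_nu E]|pd].
    by have := min _ unit_nu; rewrite E lerDl.
  split=> // nu /unshift[z_nu ->].
  by rewrite lerDl; exact: pd.
split=> //; split=> [[min uniq]|[pd spd]].
  split=> [|nu z_nu nu0 A mA]; first exact/minP.
  have [unit_nu E] := shift _ z_nu.
  have : same_measure (cadd mu nu) mu.
    by apply: uniq; split=> // nu' /min.2; rewrite E nu0 addr0.
  move=> /(_ A mA) muA; have {}muA : (mu A + nu A = mu A)%E by exact: muA.
  by rewrite -[LHS](addeK _ (fin mu A mA)) [X in (X - _)%E]addeC muA subee ?fin.
have min := minP.2 pd; split=> // nu [unit_nu min_nu] A mA.
have [z_nu E] := unshift _ unit_nu.
have nu0 : energy K (cadd nu (copp mu)) = 0.
  apply/eqP; rewrite eq_le pd// andbT.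
  by have := min_nu _ unit_mu; rewrite E gerDl.
have nuA : (nu A - mu A = 0)%E by exact: spd z_nu nu0 A mA.
by rewrite -[LHS](@subeK _ _ (mu A)) ?fin// nuA add0e.
Qed.

End energy.

Theorem theorem3p5 (R : realType) (Omega : pmetricType R)
    (K : Omega * Omega -> R) (mu : probability (borelType Omega) R) :
  compact [set: Omega] ->
  is_kernel K ->
  invariant_measure K (charge_of_finite_measure mu) ->
  (minimizes (energy K) unit_mass_measures (charge_of_finite_measure mu)
     <-> cond_posdef K) /\
  (uniquely_minimizes (energy K) unit_mass_measures
     (charge_of_finite_measure mu)
     <-> cond_strict_posdef K).
Proof.
by move=> cO kK; apply: invariant_minimizer => //; exact: probability_setT.
Qed.
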